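(* Let $\psi$ be a bounded complexity measure and $A$ a nonempty closed class of decision tables from $\mathcal{M}_k^2$. Then the function $F_{\psi,A}$ is defined everywhere on $\omega$ if and only if the function $N_{\psi,A}$ is defined everywhere on $\omega$.
   Context: Fix an integer $k\ge 2$; $\omega=\{0,1,2,\ldots\}$, $E_k=\{0,1,\ldots,k-1\}$, $E_2=\{0,1\}$. Let $P=\{f_i:i\in\omega\}$ be a set of attribute names ($f_i\ne f_j$ for $i\ne j$). $\mathcal{M}_k^2$ is the set of rectangular tables filled with numbers from $E_k$ whose columns are labeled with pairwise different attributes from $P$, whose rows are pairwise different, and in which each row is labeled with a decision from $E_2$. Tables without rows also belong to $\mathcal{M}_k^2$ and are all denoted $\Lambda$. Tables differing only by a permutation of rows are equal. $P(T)$ is the set of column attributes. $\mathcal{M}_k^2\mathcal{C}$ is the set of tables in which all rows have the same decision ($\Lambda$ included). $T(f_{i_1},\delta_1)\cdots(f_{i_m},\delta_m)$ is the table of rows of $T$ having values $\delta_1,\ldots,\delta_m$ in the columns labeled $f_{i_1},\ldots,f_{i_m}$. $N(T)$ is the number of rows of $T$. Operations: for $D\subseteq P(T)$, $I(D,T)$ deletes the columns labeled by $D$ and, in each group of rows coinciding on the remaining columns, keeps one row with the minimum decision; $I(P(T),T)=\Lambda$. For $\nu:E_k^{|P(T)|}\to E_2$, $J(\nu,T)$ replaces the decision of each row $\bar\delta$ by $\nu(\bar\delta)$. $[T]=\{J(\nu,I(D,T)):D\subseteq P(T),\nu:E_k^{|P(T)\setminus D|}\to E_2\}$; $[A]=\bigcup_{T\in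 A}[T]$; nonempty $A$ is a closed class if $[A]=A$. A $k$-decision tree: finite directed rooted tree with at least two nodes, root and its leaving edges unlabeled, terminal nodes labeled with decisions from $E_2$, other nodes labeled with attributes from $P$ whose leaving edges are labeled with numbers from $E_k$; $P(\Gamma)$ is the set of attributes at nodes. For a complete path $\tau=v_1,d_1,\ldots,v_m,d_m,v_{m+1}$ (root to terminal node), $F(\tau)$ is the empty word if $m=1$, else $f_{i_2}\cdots f_{i_m}$ where $v_j$ is labeled $f_{i_j}$; $T(\tau)=T$ if $m=1$, else $T(f_{i_2},\delta_2)\cdots(f_{i_m},\delta_m)$ with $d_j$ labeled $\delta_j$. For $T\ne\Lambda$, a deterministic decision tree for $T$: exactly one edge leaves the root, edges leaving any other nonterminal node have pairwise different labels, $P(\Gamma)\subseteq P(T)$, every row of $T$ lies in some $T(\tau)$, and for every complete path either $T(\tau)=\Lambda$ or all rows of $T(\tau)$ have the terminal node's decision. For $T\notin\mathcal{M}_k^2\mathcal{C}$, a strongly nondeterministic decision tree for $T$: all terminal nodes labeled $1$, $P(\Gamma)\subseteq P(T)$, every row of $T$ with decision $1$ lies in some $T(\tau)$, and for every complete path either $T(\tau)=\Lambda$ or all rows of $T(\tau)$ have decision $1$. Let $B$ be the set of finite words over $P$ (with empty word $\lambda$). A complexity measure is $\psi:B\to\omega$ with $\psi(\alpha)=0$ iff $\alpha=\lambda$, invariant under permutation of letters, $\psi(\alpha_1)\le\psi(\alpha_1\alpha_2)\le\psi(\alpha_1)+\psi(\alpha_2)$; bounded if $\psi(\alpha)\ge|\alpha|$.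 $\psi(\Gamma)=\max_\tau\psi(F(\tau))$ over complete paths. Parameters ($0$ on $\Lambda$): for $T\ne\Lambda$, $\psi^d(T)$ is the minimum of $\psi(\Gamma)$ over deterministic decision trees for $T$; $\psi^s(T)=0$ if $T\in\mathcal{M}_k^2\mathcal{C}$ and otherwise the minimum of $\psi(\Gamma)$ over strongly nondeterministic decision trees for $T$; $V_\psi(T)=\max\{\psi(f_i):f_i\in P(T)\}$. Partial functions: $F_{\psi,A}(n)$ is undefined if $\{\psi^d(T):T\in A,\psi^s(T)\le n\}$ is infinite, and otherwise equals its maximum. $A_\psi(n)=\{T\in A:V_\psi(T)\le n\}$; $N_{\psi,A}(n)$ is undefined if $\{N(T):T\in A_\psi(n)\}$ is infinite, and otherwise equals its maximum. *)

(* Defs.v *)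
From HB Require Import structures.
From mathcomp Require Import all_boot finmap.
From mathcomp Require Import boolp classical_sets cardinality.

Set Implicit Arguments.
Unset Strict Implicit.
Unset Printing Implicit Defensive.

Local Open Scope fset_scope.
Local Open Scope fmap_scope.
Local Open Scope classical_set_scope.

(** * Decision tables

   The attribute f_i is represented by its index i : nat, E_k by 'I_k and
   E_2 = {0, 1} by bool (0 = false, 1 = true).

   A table is the list of its column attributes (their order matters) together
   with the finite map sending each row to its decision, so that tables which
   differ only by a permutation of rows are equal.  All tables without rows are
   one and the same table, represented by ([::], [fmap]); a table with rows has
   at least one column, in agreement with I(P(T), T) = Lambda. *)

Definition table_wf k (T : seq nat * {fmap seq 'I_k -> bool}) : bool :=
  [&& uniq T.1, all (fun r => size r == size T.1) (domf T.2)
    & (T.1 == [::]) == (domf T.2 == fset0)].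

Record table (k : nat) := Table {
  table_val :> seq nat * {fmap seq 'I_k -> bool};
  table_valP : table_wf table_val }.

HB.instance Definition _ k := [isSub for @table_val k].
HB.instance Definition _ k := [Equality of table k by <:].

Definition cols k (T : table k) : seq nat := T.1.
Definition rows k (T : table k) : {fmap seq 'I_k -> bool} := T.2.

Lemma Lambda_wf k : table_wf ([::], [fmap] : {fmap seq 'I_k -> bool}).
Proof. by apply/and3P; split => //; rewrite !eqxx. Qed.

Definition Lambda k : table k := Table (Lambda_wf k).

(* The table with the given columns and rows.  Provided the columns are
   distinct and the rows have the right length (which is the case in all uses
   below, see [mk_tableE]), the default value Lambda is used exactly when there
   is no column or no row left. *)
Definition mk_table k (cs : seq nat) (rs : {fmap seq 'I_k -> bool}) : table k :=
  insubd (Lambda k) (cs, rs).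

Lemma mk_tableE k (cs : seq nat) (rs : {fmap seq 'I_k -> bool}) :
    uniq cs -> {in domf rs, forall r, size r = size cs} ->
  if (cs == [::]) || (domf rs == fset0) then mk_table cs rs = Lambda k
  else cols (mk_table cs rs) = cs /\ rows (mk_table cs rs) = rs.
Proof.
move=> cs_uniq rs_size; rewrite /mk_table /cols /rows.
have szP: all (fun r => size r == size cs) (domf rs).
  by apply/allP => r /rs_size ->.
case: ifP => [dflt | /norP[/negPf cs0 /negPf rs0]]; last first.
  by rewrite insubdK // unfold_in /table_wf /= cs_uniq szP cs0 rs0.
case: (boolP (table_wf (cs, rs))) => [wf | wf].
  have /and3P[_ _ /= /eqP E] := wf; apply: val_inj; rewrite insubdK //=.
  move: dflt; rewrite E orbb => rs0; move: E; rewrite rs0 => /eqP ->.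
  by rewrite (fmap_nil (eqP rs0)).
by apply: val_inj; rewrite val_insubd (negPf wf).
Qed.

Definition nrows k (T : table k) : nat := #|` domf (rows T)|.

(* The class M_k^2 C. *)
Definition constant_table k (T : table k) : bool :=
  [exists d : bool, [forall r : domf (rows T), rows T r == d]].

(* Value of row r in column a is i iff (a, i) \in zip (cols T) r, as the columns
   are pairwise distinct. *)
Definition satisfies k (T : table k) (w : seq (nat * 'I_k)) (r : seq 'I_k) :=
  all (mem (zip (cols T) r)) w.

(* T(f_{i_1}, d_1)...(f_{i_m}, d_m). *)
Definition subtable k (T : table k) (w : seq (nat * 'I_k)) : table k :=
  mk_table (cols T) (rows T).[& [fset r in domf (rows T) | satisfies T w r]].

(** * Operations and closed classes *)

Definition delete_entries k (D : {fset nat}) (cs : seq nat) (r : seq 'I_k) :=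
  mask [seq a \notin D | a <- cs] r.

(* On E_2, the minimum is the conjunction. *)
Definition opI k (D : {fset nat}) (T : table k) : table k :=
  mk_table [seq a <- cols T | a \notin D]
    [fmap r' : [fset delete_entries D (cols T) r | r in domf (rows T)] =>
      \big[andb/true]_(r : domf (rows T)
                      | delete_entries D (cols T) (val r) == val r') rows T r].

(* Only the values of nu on words of length |P(T)| are used. *)
Definition opJ k (nu : seq 'I_k -> bool) (T : table k) : table k :=
  mk_table (cols T) [fmap r : domf (rows T) => nu (val r)].

Definition table_closure k (T : table k) : set (table k) :=
  [set T' | exists (D : {fset nat}) (nu : seq 'I_k -> bool),
      {subset D <= cols T} /\ T' = opJ nu (opI D T)].

Definition class_closure k (A : set (table k)) : set (table k) :=
  \bigcup_(T in A) table_closure T.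

Definition closed_class k (A : set (table k)) : Prop :=
  A !=set0 /\ class_closure A = A.

(** * Decision trees *)

(* A node other than the root, with the subtree below it: a terminal node
   labeled with a decision, or a node labeled with an attribute together with
   its leaving edges (edge label and target). *)
Inductive node (k : nat) : Type :=
| Leaf of bool
| Query of nat & seq ('I_k * node k).

(* A tree is given by the list of the children of its (unlabeled) root. *)
Definition tree (k : nat) : Type := seq (node k).

Fixpoint node_ok k (v : node k) : bool :=
  match v with
  | Leaf _ => true
  | Query _ es => ~~ nilp es && all (fun e => node_ok e.2) es
  end.

(* [Query] nodes are nonterminal, and the tree has at least two nodes. *)
Definition decision_tree k (G : tree k) : bool :=
  ~~ nilp G && all (@node_ok k) G.

Fixpoint node_attrs k (v : node k) : seq nat :=
  match v with
  | Leaf _ => [::]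
  | Query a es => a :: flatten [seq node_attrs e.2 | e <- es]
  end.

Definition attrs k (G : tree k) : seq nat := flatten [seq node_attrs v | v <- G].

Fixpoint node_deterministic k (v : node k) : bool :=
  match v with
  | Leaf _ => true
  | Query _ es =>
      uniq [seq e.1 | e <- es] && all (fun e => node_deterministic e.2) es
  end.

(* A complete path is represented by the sequence of pairs (attribute of a node,
   label of the edge taken), the root and its leaving edge being omitted, and by
   the decision of its terminal node. *)
Definition cpath (k : nat) : Type := (seq (nat * 'I_k) * bool)%type.

Fixpoint node_paths k (v : node k) : seq (cpath k) :=
  match v with
  | Leaf d => [:: ([::], d)]
  | Query a es =>
      flatten [seq [seq ((a, e.1) :: t.1, t.2) | t <- node_paths e.2] | e <- es]
  end.

Definition paths k (G : tree k) : seq (cpath k) :=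
  flatten [seq node_paths v | v <- G].

(* F(tau) *)
Definition path_word k (t : cpath k) : seq nat := [seq c.1 | c <- t.1].

(* T(tau) *)
Definition path_table k (T : table k) (t : cpath k) : table k := subtable T t.1.

Definition deterministic_tree_for k (T : table k) (G : tree k) : Prop :=
  [/\ decision_tree G,
      size G = 1 /\ all (@node_deterministic k) G,
      {subset attrs G <= cols T},
      forall r, r \in domf (rows T) ->
        exists2 t, t \in paths G & r \in domf (rows (path_table T t))
    & forall t, t \in paths G -> path_table T t = Lambda k \/
        forall r : domf (rows (path_table T t)), rows (path_table T t) r = t.2].

(* Every terminal node ends some complete path. *)
Definition strongly_nondeterministic_tree_for k (T : table k) (G : tree k)
    : Prop :=
  [/\ decision_tree G,
      forall t, t \in paths G -> t.2 = true,
      {subset attrs G <= cols T},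
      forall r : domf (rows T), rows T r = true ->
        exists2 t, t \in paths G & val r \in domf (rows (path_table T t))
    & forall t, t \in paths G -> path_table T t = Lambda k \/
        forall r : domf (rows (path_table T t)), rows (path_table T t) r = true].

(** * Complexity measures and parameters *)

Definition complexity_measure (psi : seq nat -> nat) : Prop :=
  [/\ forall w, psi w = 0 <-> w = [::],
      forall w1 w2, perm_eq w1 w2 -> psi w1 = psi w2
    & forall w1 w2, psi w1 <= psi (w1 ++ w2) <= psi w1 + psi w2].

Definition bounded_measure (psi : seq nat -> nat) : Prop :=
  forall w, size w <= psi w.

Definition tree_complexity k (psi : seq nat -> nat) (G : tree k) : nat :=
  \max_(t <- paths G) psi (path_word t).

(* Minimum of a nonempty set; the default 0 is never used below, as trees of
   either kind exist for every table to which they apply (when k > 0). *)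
Definition set_min (S : set nat) : nat :=
  xget 0 [set n | S n /\ forall m, S m -> n <= m].

Definition psi_d k (psi : seq nat -> nat) (T : table k) : nat :=
  if T == Lambda k then 0
  else set_min (tree_complexity psi @` [set G | deterministic_tree_for T G]).

Definition psi_s k (psi : seq nat -> nat) (T : table k) : nat :=
  if constant_table T then 0
  else set_min
    (tree_complexity psi @` [set G | strongly_nondeterministic_tree_for T G]).

Definition V_psi k (psi : seq nat -> nat) (T : table k) : nat :=
  \max_(a <- cols T) psi [:: a].

(* Maximum of a set of natural numbers, undefined (None) if it is infinite. *)
Definition finite_max (S : set nat) : option nat :=
  if `[< finite_set S >] then Some (\max_(n <- fset_set S) n) else None.

(* Partial functions omega -> omega are functions to option nat. *)
Definition defined_everywhere (f : nat -> option nat) : Prop :=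
  forall n, exists m, f n = Some m.

Definition F_fun k (psi : seq nat -> nat) (A : set (table k)) (n : nat) :
    option nat :=
  finite_max [set psi_d psi T | T in [set T | A T /\ psi_s psi T <= n]].

Definition A_psi k (psi : seq nat -> nat) (A : set (table k)) (n : nat) :
    set (table k) :=
  [set T | A T /\ V_psi psi T <= n].

Definition N_fun k (psi : seq nat -> nat) (A : set (table k)) (n : nat) :
    option nat :=
  finite_max [set nrows T | T in A_psi psi A n].

(* Main.v *)
(* From N to F: the paths of an optimal strongly nondeterministic tree use only
   columns of weight at most n, and these determine the decision.  Projecting T
   on them gives a table of the class with at most N(n) rows, so N(n) of these
   columns suffice to separate its rows; querying them all decides T at cost at
   most n * N(n).

   From F to N: let V(T) <= n and project T, without merging rows, on a
   separating set of at most N(T) columns.  If the row r gets decision 0 and the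
   others 1, then psi^s <= n, since a single column tells r from any given other
   row.  Hence psi^d <= h := F(n), and the path of r in a deterministic tree is
   a word of weight at most h that isolates r.  As each row can be isolated at
   cost h, every choice of decisions has psi^s <= h, and so psi^d <= F(h).  But
   there are 2^N(T) choices of decisions and, with at most N(T) columns, only
   polynomially many (in N(T)) trees of depth F(h), so N(T) is bounded. *)

Require Import Defs.
From HB Require Import structures.
From mathcomp Require Import all_boot finmap.
From mathcomp Require Import boolp classical_sets cardinality.
From mathcomp Require Import zify.

Set Implicit Arguments.
Unset Strict Implicit.
Unset Printing Implicit Defensive.

Local Open Scope fset_scope.
Local Open Scope fmap_scope.
Local Open Scope nat_scope.

(* Classical equality, needed only to write membership in lists of nodes. *)
HB.instance Definition _ k := gen_eqMixin (node k).

(** * Bounded sets of natural numbers *)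

(** A set of naturals is finite exactly when it is bounded, so only bounds, never exact maxima, have
    to be handled below. *)
Lemma finite_maxP (S : set nat) :
  (exists m, finite_max S = Some m) <-> exists b, forall n, S n -> n <= b.
Proof.
rewrite /finite_max; case: ifP => /asboolP finS; split=> [] [b] //.
- move=> _; exists (\max_(n <- fset_set S) n) => n Sn.
  by apply: leq_bigmax_seq; rewrite // in_fset_set // inE.
- by exists (\max_(n <- fset_set S) n).
- move=> Sb; case: finS; apply: (sub_finite_set _ (finite_II b.+1)) => n /Sb.
  by rewrite /= ltnS.
Qed.

Lemma set_min_image (X : Type) (f : X -> nat) (P : X -> Prop) x : P x ->
  (exists2 y, P y & f y = set_min (f @` [set z | P z])%classic) /\
  set_min (f @` [set z | P z])%classic <= f x.
Proof.
move=> Px; set S := (f @` _)%classic.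
have exS : exists m, `[< S m >] by exists (f x); apply/asboolP; exists x.
have: exists m, S m /\ forall p, S p -> m <= p.
  case: (ex_minnP exS) => m /asboolP Sm minm; exists m; split=> // p Sp.
  exact/minm/asboolP.
by case/(xgetPex 0) => Sm minS; split; [exact: Sm | apply: minS; exists x].
Qed.

(** * Entries of a row addressed by attribute *)

(** Addressing an entry by attribute instead of position makes it insensitive to the deletion of
    other columns. *)
Definition cell (K : Type) (cs : seq nat) (r : seq K) (a : nat) : option K :=
  onth r (index a cs).

Section Cells.
Variable k : nat.
Implicit Types (cs S : seq nat) (r u : seq 'I_k).

Lemma mem_zip_cell cs r a i : uniq cs -> size r = size cs ->
  ((a, i) \in zip cs r) = (cell cs r a == Some i).
Proof.
rewrite /cell; elim: cs r => [|b cs IH] [|j r] //= /andP[bcs ucs] [szr].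
rewrite inE xpair_eqE; have [<- /=|ab] := eqVneq b a.
  suff /negPf -> : (b, i) \notin zip cs r by rewrite orbF eq_sym.
  by apply: contra bcs => /(map_f fst); rewrite -/unzip1 unzip1_zip ?szr.
by rewrite /= IH.
Qed.

Lemma cell_some cs r a : size r = size cs -> a \in cs ->
  exists i, cell cs r a = Some i.
Proof.
move=> szr; rewrite -index_mem -szr -onthTE /cell.
by case: onth => // i _; exists i.
Qed.

Lemma cell_ext cs r u : uniq cs -> size r = size cs -> size u = size cs ->
  {in cs, cell cs r =1 cell cs u} -> r = u.
Proof.
move=> ucs szr szu eqc; apply: eq_from_onth_le => j.
rewrite szr szu maxnn => jlt; have /eqc := mem_nth 0 jlt.
by rewrite /cell index_uniq.
Qed.

Lemma size_delete_entries D cs r : size r = size cs ->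
  size (delete_entries D cs r) = size [seq a <- cs | a \notin D].
Proof.
move=> szr; rewrite /delete_entries size_mask ?size_map //.
by rewrite count_map size_filter.
Qed.

Lemma cell_delete D cs r a : a \notin D -> size r = size cs ->
  cell [seq b <- cs | b \notin D] (delete_entries D cs r) a = cell cs r a.
Proof.
move=> aD; rewrite /cell /delete_entries.
elim: cs r => [|b cs IH] [|i r] //= [szr].
case: ifP => /= bD; first by case: eqP => //= _; apply: IH.
by have [ba|_] := eqVneq b a; [rewrite ba aD in bD | apply: IH].
Qed.

End Cells.

(** * Tables and subtables *)

Section Tables.
Variable k : nat.
Implicit Types (T : table k) (r : seq 'I_k).

Lemma uniq_cols T : uniq (cols T).
Proof. by have /and3P[] := table_valP T. Qed.

Lemma size_row T r : r \in domf (rows T) -> size r = size (cols T).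
Proof. by have /and3P[_ /allP szT _] := table_valP T => /szT/eqP. Qed.

Lemma row_ext T : {in domf (rows T) &, forall r r',
  {in cols T, cell (cols T) r =1 cell (cols T) r'} -> r = r'}.
Proof.
move=> r r' /size_row szr /size_row szr'.
exact: cell_ext (uniq_cols T) szr szr'.
Qed.

Lemma cols_nil T : (cols T == [::]) = (domf (rows T) == fset0).
Proof. by have /and3P[_ _ /eqP] := table_valP T. Qed.

Lemma LambdaP T : reflect (T = Lambda k) (domf (rows T) == fset0).
Proof.
apply: (iffP eqP) => [T0|->] //; apply: val_inj => /=.
have /eqP cT : cols T == [::] by rewrite cols_nil T0.
move: T0 cT; rewrite /rows /cols.
by case: (table_val T) => c m /= /fmap_nil -> ->.
Qed.

(** The third hypothesis handles the default [Lambda]: without columns there are no rows either, so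
    the rows are always right, and only the columns of a table without rows can be lost. *)
Lemma rows_mk_table (cs : seq nat) (m : {fmap seq 'I_k -> bool}) :
    uniq cs -> {in domf m, forall r, size r = size cs} ->
    (cs == [::] -> domf m == fset0) ->
  rows (mk_table cs m) = m /\ (domf m != fset0 -> cols (mk_table cs m) = cs).
Proof.
move=> ucs szm cs0; have := mk_tableE ucs szm.
case: ifP => [m0|_ [-> ->] //] ->.
have /eqP m0' : domf m == fset0 by case/orP: m0.
by rewrite m0' eqxx; split=> //; rewrite (fmap_nil m0').
Qed.

Lemma rows_subtable T w :
  rows (subtable T w) =
    (rows T).[& [fset r in domf (rows T) | satisfies T w r]].
Proof.
rewrite /subtable; set m := (rows T).[& _].
have szm : {in domf m, forall r, size r = size (cols T)}.
  by move=> r; rewrite domf_restrict inE => /andP[_]; apply: size_row.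
suff m0 : cols T == [::] -> domf m == fset0.
  by case: (rows_mk_table (uniq_cols T) szm m0).
by rewrite cols_nil domf_restrict => /eqP ->; rewrite fsetI0.
Qed.

Lemma mem_subtable T w r :
  (r \in domf (rows (subtable T w))) =
    (r \in domf (rows T)) && satisfies T w r.
Proof.
rewrite rows_subtable domf_restrict !inE /=.
by case: (r \in _) => //=; rewrite ?andbT ?andbF.
Qed.

Lemma fnd_subtable T w r : r \in domf (rows (subtable T w)) ->
  (rows (subtable T w)).[? r] = (rows T).[? r].
Proof.
by rewrite mem_subtable rows_subtable fnd_filterf !inE => ->.
Qed.

(** Both kinds of trees impose the left side on their paths. An empty subtable meets the right side
    vacuously, so the case [Lambda] disappears. *)
Lemma subtable_constantP T w d :
  (subtable T w = Lambda k \/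
    forall r : domf (rows (subtable T w)), rows (subtable T w) r = d) <->
  forall r, r \in domf (rows T) -> satisfies T w r -> (rows T).[? r] = Some d.
Proof.
split=> [H r rT rw|H].
  have rS : r \in domf (rows (subtable T w)) by rewrite mem_subtable rT.
  have Hd : rows (subtable T w) [` rS] = d.
    case: H => // /LambdaP T0.
    by have /fset0Pn/negP[] : exists r, r \in domf (rows (subtable T w));
      first by exists r.
  by have := in_fnd rS; rewrite Hd fnd_subtable.
right=> r; have := valP r; rewrite mem_subtable => /andP[/H Hr {}/Hr Hr].
by apply: Some_inj; rewrite Some_fnd fnd_subtable ?fsvalP.
Qed.

Lemma satisfiesP T w r : r \in domf (rows T) ->
  reflect (forall c, c \in w -> cell (cols T) r c.1 = Some c.2)
          (satisfies T w r).
Proof.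
move=> rT; have E a i := mem_zip_cell a i (uniq_cols T) (size_row rT).
apply: (iffP allP) => H [a i] /H => [m|/eqP]; last by rewrite -E.
by apply/eqP; rewrite -E.
Qed.

Lemma constant_tableP T :
  reflect (exists d, forall r, r \in domf (rows T) -> (rows T).[? r] = Some d)
          (constant_table T).
Proof.
apply: (iffP existsP) => -[d H]; exists d.
  by move=> r rT; rewrite in_fnd; move/forallP: H => /(_ [` rT])/eqP ->.
by apply/forallP => r; apply/eqP/Some_inj; rewrite Some_fnd H ?fsvalP.
Qed.

End Tables.

(** * Operations and projections within a closed class *)

Section Operations.
Variable k : nat.
Implicit Types (T : table k) (nu : seq 'I_k -> bool).

Lemma opJ_rows nu T :
  [/\ domf (rows (opJ nu T)) = domf (rows T), cols (opJ nu T) = cols T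
    & forall r, r \in domf (rows T) -> (rows (opJ nu T)).[? r] = Some (nu r)].
Proof.
rewrite /opJ; set m : {fmap _ -> _} := [fmap r : domf (rows T) => _].
have m0 : cols T == [::] -> domf m == fset0 by rewrite cols_nil.
have [-> colsE] := rows_mk_table (m := m) (uniq_cols T) (@size_row _ T) m0.
split=> // [|r rT]; last by rewrite in_fnd ffunE.
have [T0|/colsE //] := eqVneq (domf m) fset0.
have /LambdaP-> : domf (rows (mk_table (cols T) m)) == fset0.
  have [-> _] := rows_mk_table (m := m) (uniq_cols T) (@size_row _ T) m0.
  exact/eqP.
by have /LambdaP-> : domf (rows T) == fset0 by apply/eqP.
Qed.

(** Decisions are not recorded, because an application of [opJ] will overwrite them. *)
Lemma opI_rows D T : let cs := [seq a <- cols T | a \notin D] in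
  cs != [::] -> T <> Lambda k ->
  domf (rows (opI D T)) =
    [fset delete_entries D (cols T) r | r in domf (rows T)]
  /\ cols (opI D T) = cs.
Proof.
move=> cs cs0 TL; rewrite /opI -/cs.
set m : {fmap _ -> _} := [fmap r' : _ => _].
have szm : {in domf m, forall r, size r = size cs}.
  by move=> _ /imfsetP[r /= rT ->]; rewrite size_delete_entries ?(size_row rT).
have m0 : cs == [::] -> domf m == fset0 by rewrite (negPf cs0).
have [-> colsE] := rows_mk_table (m := m) (filter_uniq _ (uniq_cols T)) szm m0.
split=> //; apply: colsE.
have /fset0Pn[r rT] : domf (rows T) != fset0 by apply/LambdaP.
by apply/fset0Pn; exists (delete_entries D (cols T) r); apply: in_imfset.
Qed.

Lemma closed_class_opJI (A : set (table k)) D nu T : closed_class A ->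
  A T -> {subset D <= cols T} -> A (opJ nu (opI D T)).
Proof. by move=> hA AT DT; rewrite -hA.2; exists T => //; exists D, nu. Qed.

Definition outside (C : seq nat) T : {fset nat} :=
  [fset a in [seq a <- cols T | a \notin C]].

Lemma outside_sub C T : {subset outside C T <= cols T}.
Proof. by move=> a; rewrite !inE mem_filter => /andP[]. Qed.

Lemma filter_outside C T :
  [seq a <- cols T | a \notin outside C T] = [seq a <- cols T | a \in C].
Proof.
by apply: eq_in_filter => a aT; rewrite !inE mem_filter aT andbT negbK.
Qed.

(** Since $J$ acts after $I$, the minimum decisions are erased and the projected rows may carry any
    decisions. *)
Lemma closed_class_project (A : set (table k)) C nu T : closed_class A ->
  A T -> T <> Lambda k -> [seq a <- cols T | a \in C] != [::] ->
  exists T', [/\ A T', cols T' = [seq a <- cols T | a \in C],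
    domf (rows T') = [fset delete_entries (outside C T) (cols T) r
                        | r in domf (rows T)]
  & forall r, r \in domf (rows T') -> (rows T').[? r] = Some (nu r)].
Proof.
move=> hA AT TL; rewrite -filter_outside => cs0.
have [dI cI] := opI_rows cs0 TL; exists (opJ nu (opI (outside C T) T)).
have [dJ cJ rJ] := opJ_rows nu (opI (outside C T) T).
split=> [||| r rJT]; last by apply: rJ; rewrite -dJ.
- by apply: closed_class_opJI => //; apply: outside_sub.
- by rewrite cJ.
- by rewrite dJ.
Qed.

Lemma cell_project C T r a : r \in domf (rows T) -> a \in C -> a \in cols T ->
  cell [seq a <- cols T | a \in C] (delete_entries (outside C T) (cols T) r) a
    = cell (cols T) r a.
Proof.
move=> rT aC aT; rewrite -filter_outside cell_delete ?(size_row rT) //.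
by rewrite !inE mem_filter aC.
Qed.

End Operations.

(** * Separating sets of columns *)

(** Greedy choice: a new element x can clash on S with only one class of earlier elements, those
    that agree with some y on C, so one further column is enough. *)
Lemma separating_seq (X : eqType) (Y : eqType) (f : X -> nat -> Y) (s : seq X)
    (C : seq nat) :
  exists S, [/\ {subset S <= C}, size S <= size s
    & {in s &, forall x y, {in S, f x =1 f y} -> {in C, f x =1 f y}}].
Proof.
elim: s => [|x s [S [SC szS sepS]]]; first by exists [::].
have [[y [ys xyS [a aC neq]]]|nex] := pselect (exists y,
    [/\ y \in s, {in S, f x =1 f y} & exists2 a, a \in C & f x a <> f y a]).
  (* Such a z agrees with y on S, hence on C and in particular at a, where x would then equal y. *)
  have neqx z : z \in s -> {in a :: S, f x =1 f z} -> False.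
    move=> zs xz; apply: neq; rewrite (xz a) ?mem_head //.
    apply: sepS => // b bS; rewrite -xyS // xz // inE bS orbT //.
  exists (a :: S); split=> //.
    by move=> b; rewrite inE => /orP[/eqP->|/SC].
  move=> y' z'; rewrite !inE => /orP[/eqP->|ys'] /orP[/eqP->|zs'] // H.
  - by case: (neqx _ zs' H).
  - by case: (neqx _ ys') => b /H ->.
  - by apply: sepS => // b bS; apply: H; rewrite inE bS orbT.
have sepx z : z \in s -> {in S, f x =1 f z} -> {in C, f x =1 f z}.
  move=> zs xz a aC; apply: contrapT => neq; apply: nex.
  by exists z; split=> //; exists a.
exists S; split=> //; first exact: leqW.
move=> y z; rewrite !inE => /orP[/eqP->|ys] /orP[/eqP->|zs] // H.
- exact: sepx.
- by move=> b bC; apply/esym/sepx => // c /H ->.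
- exact: sepS.
Qed.

(** * Construction of decision trees *)

Section Trees.
Variable k : nat.
Implicit Types (T : table k) (G : tree k) (v : node k) (t : cpath k).
Implicit Types (r u : seq 'I_k).

Lemma cell_mem T r a i : r \in domf (rows T) ->
  cell (cols T) r a = Some i -> a \in cols T.
Proof.
by move=> rT ca; rewrite -index_mem -(size_row rT) -onthTE -/(cell _ _ _) ca.
Qed.

Lemma deterministic_treeP T G : deterministic_tree_for T G <->
  [/\ decision_tree G, size G = 1 /\ all (@node_deterministic k) G,
      {subset attrs G <= cols T},
      forall r, r \in domf (rows T) ->
        exists2 t, t \in paths G & satisfies T t.1 r
    & forall t, t \in paths G -> forall r, r \in domf (rows T) ->
        satisfies T t.1 r -> (rows T).[? r] = Some t.2].
Proof.
split=> -[okG detG attrG covG constG]; split=> // [r rT|t tG].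
- by have [t tG] := covG r rT; rewrite mem_subtable => /andP[_]; exists t.
- exact/subtable_constantP/constG.
- by have [t tG tr] := covG r rT; exists t; rewrite // mem_subtable rT.
- exact/subtable_constantP/constG.
Qed.

Lemma strongly_nondeterministic_treeP T G :
  strongly_nondeterministic_tree_for T G <->
  [/\ decision_tree G, forall t, t \in paths G -> t.2 = true,
      {subset attrs G <= cols T},
      forall r, (rows T).[? r] = Some true ->
        exists2 t, t \in paths G & satisfies T t.1 r
    & forall t, t \in paths G -> forall r, r \in domf (rows T) ->
        satisfies T t.1 r -> (rows T).[? r] = Some true].
Proof.
split=> -[okG detG attrG covG constG]; split=> // [r rT|t tG].
- have rD : r \in domf (rows T) by rewrite -fndSome rT.
  have [|t tG] := covG [` rD]; first by apply: Some_inj; rewrite Some_fnd.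
  by rewrite mem_subtable => /andP[_]; exists t.
- exact/subtable_constantP/constG.
- have [|t tG tr] := covG (val r); first by rewrite -Some_fnd rT.
  by exists t; rewrite // mem_subtable fsvalP.
- exact/subtable_constantP/constG.
Qed.

Lemma tree_complexity_le psi G n :
  (forall t, t \in paths G -> psi (path_word t) <= n) ->
  tree_complexity psi G <= n.
Proof. by move=> le_n; apply/bigmax_leqP_seq => t tG _; apply: le_n. Qed.

Lemma tree_complexity_ge psi G t :
  t \in paths G -> psi (path_word t) <= tree_complexity psi G.
Proof. by move=> tG; apply: leq_bigmax_seq. Qed.

(** Non-adaptive: S is queried in order whatever the answers, so all path words equal S; g turns the
    list of answers into a decision. *)
Fixpoint query_tree (S : seq nat) (g : seq 'I_k -> bool) : node k :=
  if S is a :: S' then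
    Query a [seq (i, query_tree S' (fun u => g (i :: u))) | i <- enum 'I_k]
  else Leaf k (g [::]).

Lemma query_tree_paths S g t : t \in node_paths (query_tree S g) ->
  exists2 u, size u = size S & t = (zip S u, g u).
Proof.
elim: S g t => [|a S IH] g t /=; first by rewrite inE => /eqP ->; exists [::].
case/flattenP => _ /mapP[_ /mapP[i _ ->] ->] /mapP[t' /IH[u szu ->] ->] /=.
by exists (i :: u); rewrite //= szu.
Qed.

Lemma query_tree_path S g u : size u = size S ->
  (zip S u, g u) \in node_paths (query_tree S g).
Proof.
elim: S g u => [|a S IH] g [|i u] //=; first by rewrite mem_head.
case=> szu.
apply/flattenP; eexists.
  by apply/mapP; eexists; [apply/mapP; exists i; rewrite ?mem_enum|].
by apply/mapP; exists (zip S u, g (i :: u)) => //=; apply: IH.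
Qed.

Lemma query_tree_ok S g : 0 < k -> node_ok (query_tree S g).
Proof.
move=> k0; elim: S g => //= a S IH g; apply/andP; split.
  by rewrite /nilp size_map size_enum_ord -lt0n.
by rewrite all_map; apply/allP => i _ /=.
Qed.

Lemma query_tree_deterministic S g : node_deterministic (query_tree S g).
Proof.
elim: S g => //= a S IH g; apply/andP; split; last first.
  by rewrite all_map; apply/allP => i _ /=.
by rewrite -map_comp map_id_in // enum_uniq.
Qed.

Lemma query_tree_attrs S g : {subset node_attrs (query_tree S g) <= S}.
Proof.
elim: S g => //= a S IH g b; rewrite !inE => /orP[->//|].
by case/flattenP => _ /mapP[_ /mapP[i _ ->] ->] /IH ->; rewrite orbT.
Qed.

Lemma satisfying_word T S r : r \in domf (rows T) -> {subset S <= cols T} ->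
  exists2 u, size u = size S & satisfies T (zip S u) r.
Proof.
move=> rT; elim: S => [|a S IH] ST; first by exists [::].
have [|u szu ur] := IH; first by move=> b bS; apply: ST; rewrite inE bS orbT.
have [i ci] := cell_some (size_row rT) (ST _ (mem_head _ _)).
exists (i :: u); first by rewrite /= szu.
apply/(satisfiesP _ rT) => c; rewrite inE => /orP[/eqP->//|].
by move: c; apply/(satisfiesP _ rT).
Qed.

Lemma satisfies_agree T S u r r' : size u = size S ->
  r \in domf (rows T) -> r' \in domf (rows T) ->
  satisfies T (zip S u) r -> satisfies T (zip S u) r' ->
  {in S, cell (cols T) r =1 cell (cols T) r'}.
Proof.
move=> szu rT r'T /(satisfiesP _ rT) ur /(satisfiesP _ r'T) ur' a.
rewrite -[S in a \in S](@unzip1_zip _ _ S u) ?szu // => /mapP[c cS ->].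
by rewrite ur // ur'.
Qed.

Lemma query_tree_for T S : 0 < k -> {subset S <= cols T} ->
    {in domf (rows T) &, forall r r',
      {in S, cell (cols T) r =1 cell (cols T) r'} ->
      (rows T).[? r] = (rows T).[? r']} ->
  exists2 G, deterministic_tree_for T G
    & forall t, t \in paths G -> path_word t = S.
Proof.
move=> k0 ST decS.
(* Rows with the same answers share their decision, so one witness with decision 1 settles the leaf;
   leaves reached by no row get 0. *)
pose g u :=
  `[< exists2 r, satisfies T (zip S u) r & (rows T).[? r] = Some true >].
exists [:: query_tree S g]; last first.
  by move=> t; rewrite /paths /= cats0 => /query_tree_paths[u szu ->];
    apply: unzip1_zip; rewrite szu.
apply/deterministic_treeP; rewrite /attrs /paths /= !cats0; split.
- by rewrite /decision_tree /= query_tree_ok.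
- by rewrite query_tree_deterministic.
- by move=> a /query_tree_attrs/ST.
- move=> r rT; have [u szu ur] := satisfying_word rT ST.
  by exists (zip S u, g u) => //; apply: query_tree_path.
move=> _ /query_tree_paths[u szu ->] r rT /= ur.
rewrite /g; case: asboolP => [[r' ur' r'1]|no].
  have r'T : r' \in domf (rows T) by rewrite -fndSome r'1.
  by rewrite (decS _ r') //; apply: satisfies_agree ur ur'.
rewrite in_fnd /=; congr Some; apply: contra_notF no => r1.
by exists r; rewrite // in_fnd r1.
Qed.

Lemma deterministic_tree_exists T : 0 < k ->
  exists G, deterministic_tree_for T G.
Proof.
move=> k0; have [//||G dG _] := @query_tree_for T (cols T) k0; last by exists G.
by move=> r r' rT r'T H; congr (_.[? _]); apply: row_ext H.
Qed.

Lemma psi_d_tree psi T : 0 < k -> T <> Lambda k ->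
  exists2 G, deterministic_tree_for T G & tree_complexity psi G = psi_d psi T.
Proof.
move=> k0 TL; have [G0 dG0] := deterministic_tree_exists T k0.
rewrite /psi_d; case: eqP => // _.
by case: (set_min_image (tree_complexity psi) dG0).
Qed.

Lemma psi_d_le psi T S : 0 < k -> T <> Lambda k -> {subset S <= cols T} ->
    {in domf (rows T) &, forall r r',
      {in S, cell (cols T) r =1 cell (cols T) r'} ->
      (rows T).[? r] = (rows T).[? r']} ->
  psi_d psi T <= psi S.
Proof.
move=> k0 TL ST decS; have [G dG pG] := query_tree_for k0 ST decS.
rewrite /psi_d; case: eqP => // _.
have [_ leG] := set_min_image (tree_complexity psi) dG.
by apply: (leq_trans leG); apply: tree_complexity_le => t /pG ->.
Qed.

(** A single path checking the certificate w; a strongly nondeterministic tree may hang many of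
    these below its root. *)
Definition chain (w : seq (nat * 'I_k)) : node k :=
  foldr (fun c v => Query c.1 [:: (c.2, v)]) (Leaf k true) w.

Lemma chain_paths w : node_paths (chain w) = [:: (w, true)].
Proof. by elim: w => //= -[a i] w -> /=. Qed.

Lemma chain_attrs w : node_attrs (chain w) = unzip1 w.
Proof. by elim: w => //= c w ->; rewrite cats0. Qed.

Lemma chain_ok w : node_ok (chain w).
Proof. by elim: w => //= c w ->. Qed.

Lemma nonconstant_rows T d : ~~ constant_table T ->
  exists2 r, r \in domf (rows T) & (rows T).[? r] = Some d.
Proof.
move=> ncT; apply: contrapT => no; case/constant_tableP: ncT; exists (~~ d).
move=> r rT; rewrite in_fnd; congr Some; apply: contra_notP no => /eqP rd.
by exists r; rewrite // in_fnd; congr Some; case: d (rows T _) rd => [] [].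
Qed.

(** One chain is taken for each row with decision 1. The predicate [P] stands for a cost bound, or
    is trivial when only existence matters. *)
Lemma certificate_tree T (P : seq (nat * 'I_k) -> Prop) : ~~ constant_table T ->
    (forall r, (rows T).[? r] = Some true ->
      exists w, [/\ P w, satisfies T w r & forall r', r' \in domf (rows T) ->
        satisfies T w r' -> (rows T).[? r'] = Some true]) ->
  exists2 G, strongly_nondeterministic_tree_for T G
    & forall t, t \in paths G -> P t.1.
Proof.
move=> ncT certT.
have {}certT r : exists w, (rows T).[? r] = Some true ->
      [/\ P w, satisfies T w r & forall r', r' \in domf (rows T) ->
        satisfies T w r' -> (rows T).[? r'] = Some true].
  by have [/certT[w]|] := pselect ((rows T).[? r] = Some true);
    [exists w | exists [::]].
have [cert certP] := choice certT.
pose ones := [seq r <- domf (rows T) | (rows T).[? r] == Some true].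
have onesP r : r \in ones -> (rows T).[? r] = Some true.
  by rewrite mem_filter => /andP[/eqP].
have ones_mem r : (rows T).[? r] = Some true -> r \in ones.
  by move=> r1; rewrite mem_filter r1 eqxx -fndSome r1.
pose G := [seq chain (cert r) | r <- ones].
have pathsG t : t \in paths G -> exists2 r, r \in ones & t = (cert r, true).
  case/flattenP => _ /mapP[_ /mapP[r r1 ->] ->].
  by rewrite chain_paths inE => /eqP; exists r.
exists G; last first.
  by move=> _ /pathsG[r /onesP/certP[Pr _ _] ->].
apply/strongly_nondeterministic_treeP; split.
(* A nonconstant table has a row with decision 1, so the root has a child. *)
- rewrite /decision_tree; apply/andP; split.
    have [r _ /ones_mem r1] := nonconstant_rows true ncT.
    by rewrite /nilp size_map -lt0n; case: (ones) r1.
  by rewrite all_map; apply/allP => r _; apply: chain_ok.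
- by move=> _ /pathsG[r _ ->].
- move=> a /flattenP[_ /mapP[_ /mapP[r /onesP r1 ->] ->]].
  rewrite chain_attrs => /mapP[c cr ->].
  have rT : r \in domf (rows T) by rewrite -fndSome r1.
  have [_ /(satisfiesP _ rT)/(_ _ cr) rc _] := certP _ r1.
  exact: cell_mem rc.
- move=> r r1; exists (cert r, true); last by have [] := certP _ r1.
  apply/flattenP; exists [:: (cert r, true)]; last exact: mem_head.
  rewrite -chain_paths; apply/map_f/map_f/ones_mem/r1.
by move=> _ /pathsG[r /onesP/certP[_ _ H] ->].
Qed.

Lemma psi_s_le psi T n :
    (forall r, (rows T).[? r] = Some true ->
      exists w, [/\ psi (unzip1 w) <= n, satisfies T w r
        & forall r', r' \in domf (rows T) ->
            satisfies T w r' -> (rows T).[? r'] = Some true]) ->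
  psi_s psi T <= n.
Proof.
rewrite /psi_s; case: ifP => // /negbT ncT certT.
have [G sG Gn] := certificate_tree ncT certT.
have [_ leG] := set_min_image (tree_complexity psi) sG.
by apply: (leq_trans leG); apply: tree_complexity_le => t /Gn.
Qed.

(** A tree exists because each row, read in all columns, is its own certificate. *)
Lemma psi_s_tree psi T : ~~ constant_table T ->
  exists2 G, strongly_nondeterministic_tree_for T G
    & tree_complexity psi G = psi_s psi T.
Proof.
move=> ncT; have [|G0 sG0 _] := @certificate_tree T (fun=> True) ncT.
  move=> r r1; have rT : r \in domf (rows T) by rewrite -fndSome r1.
  have [u szu ur] := satisfying_word rT (fun a => id).
  exists (zip (cols T) u); split=> // r' r'T ur'; rewrite -r1; congr (_.[? _]).
  by apply: (row_ext r'T rT); apply: satisfies_agree ur' ur.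
rewrite /psi_s (negPf ncT).
by case: (set_min_image (tree_complexity psi) sG0).
Qed.

End Trees.

(** * Counting trees of bounded depth *)

Lemma sqr_le_exp2 q : 4 <= q -> q * q <= 2 ^ q.
Proof.
elim: q => // q IH; rewrite leq_eqVlt => /orP[/eqP <- //|]; rewrite ltnS => q4.
by rewrite expnS; have := IH q4; nia.
Qed.

Lemma exp2_le_poly_bounded M :
  exists B, forall N, 2 ^ N <= (2 * N.+1) ^ M -> N <= B.
Proof.
(* Taking roots of order $M+1$ gives $2^q \le 2(N+1)$, which is linear in $q$; comparison with $q^2
   \le 2^q$ yields $q \le 4(M+1)+3$, and $N < (q+1)(M+1)$ yields the bound. *)
exists ((4 * M.+1 + 4) * M.+1) => N le_pow; set q := N %/ M.+1.
have N_lt : N < q.+1 * M.+1 by rewrite ltn_ceil.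
suff : q <= 4 * M.+1 + 3 by nia.
have : 2 ^ q <= 2 * N.+1.
  rewrite -(leq_exp2r _ _ (ltn0Sn M)) -expnM.
  apply: (leq_trans (leq_pexp2l _ (leq_divM N M.+1))) => //.
  by apply: (leq_trans le_pow); rewrite leq_pexp2l.
by have [q3|/sqr_le_exp2] := leqP q 3; nia.
Qed.

(* Trees of depth h whose queries are column positions 0, .., c rather than
   attributes, with a child for each answer. *)
Fixpoint full_tree (k c h : nat) : finType :=
  if h is h'.+1 then ('I_c.+1 * {ffun 'I_k -> full_tree k c h'})%type
  else bool.

Fixpoint full_tree_eval k c h : full_tree k c h -> seq 'I_k -> bool :=
  match h return full_tree k c h -> seq 'I_k -> bool with
  | 0 => fun d _ => d
  | h'.+1 => fun p r =>
      if onth r p.1 is Some i then full_tree_eval (p.2 i) r else false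
  end.

(** In $(k+1)^{h+1} = (k+1)^h + (k+1)^h k$ the first summand pays for the position queried at the
    root, the second for its $k$ subtrees. For fixed $k$ and $h$ the bound is polynomial in $c$. *)
Lemma card_full_tree k c h :
  #|full_tree k c h| <= (2 * c.+1) ^ (k.+1 ^ h).
Proof.
elim: h => [|h IH]; first by rewrite card_bool expn0 expn1 leq_pmulr.
rewrite [full_tree _ _ _]/= -/(full_tree k c h).
rewrite card_prod card_ord card_ffun card_ord.
have -> : k.+1 ^ h.+1 = k.+1 ^ h + k.+1 ^ h * k by rewrite expnSr mulnS.
rewrite expnD (expnM _ _ k); apply: leq_mul; last first.
  by have [->|k0] := posnP k; rewrite ?expn0 ?leq_exp2r.
apply: (@leq_trans ((2 * c.+1) ^ 1)); first by rewrite expn1 leq_pmull.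
by rewrite leq_pexp2l ?muln_gt0 // expn_gt0.
Qed.

Section FullTrees.
Variables (k c : nat) (cs : seq nat).
Hypothesis cs_le : size cs <= c.+1.

Definition agrees (w : seq (nat * 'I_k)) (r : seq 'I_k) :=
  forall p, p \in w -> cell cs r p.1 = Some p.2.

(** Pads a leaf to depth h with dummy queries of position 0, which every nonempty row answers. *)
Lemma full_tree_const h d : exists p : full_tree k c h,
  forall r, size r = size cs -> 0 < size cs -> full_tree_eval p r = d.
Proof.
elim: h => [|h [p pd]]; first by exists d.
exists (ord0, [ffun=> p]) => -[|i r] szr cs0; first by rewrite -szr in cs0.
by rewrite /= ffunE; apply: pd.
Qed.

(** Attributes become positions, early leaves are padded, and answers without an edge get an
    arbitrary subtree. *)
Lemma full_tree_of_node h (v : node k) : 0 < size cs ->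
    node_deterministic v -> {subset node_attrs v <= cs} ->
    (forall t, t \in node_paths v -> size t.1 <= h) ->
  exists p : full_tree k c h, forall r t, size r = size cs ->
    t \in node_paths v -> agrees t.1 r -> full_tree_eval p r = t.2.
Proof.
move=> cs0; elim: h v => [|h IH] [d|a es] /=.
- by move=> *; exists d => r t _; rewrite inE => /eqP->.
(* Every path through a query has positive length, so at depth 0 there is no path to respect. *)
- move=> _ _ size0; exists true => r t _ /[dup] tv /size0.
  by case/flattenP: tv => _ /mapP[e _ ->] /mapP[t' _ ->].
- move=> *; have [p pd] := full_tree_const h.+1 d; exists p => r t szr.
  by rewrite inE => /eqP-> _; apply: pd.
case/andP=> uniq_es /allP det_es attr_es size_es.
have acs : a \in cs by apply: attr_es; rewrite mem_head.
have /fin_all_exists[g gP] i : exists p : full_tree k c h,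
    forall e, e \in es -> e.1 = i -> forall r t, size r = size cs ->
    t \in node_paths e.2 -> agrees t.1 r -> full_tree_eval p r = t.2.
  have [[e ees ei]|no] := pselect (exists2 e, e \in es & e.1 = i); last first.
    have [p _] := full_tree_const h true; exists p => e ees ei.
    by case: no; exists e.
  have [|||p pP] := IH e.2.
  - exact: det_es.
  - move=> b be; apply: attr_es; rewrite inE; apply/orP; right.
    by apply/flattenP; exists (node_attrs e.2) => //; apply/mapP; exists e.
  - move=> t te; have := size_es ((a, e.1) :: t.1, t.2); rewrite ltnS; apply.
    by apply/flattenP; eexists; [apply/mapP; exists e | apply/mapP; exists t].
  (* Determinism: edge labels are distinct, so only one edge carries the answer i. *)
  exists p => e' e'es e'i; suff -> : e' = e by [].
  have lt_index x : x \in es -> index x es < size es by rewrite index_mem.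
  rewrite -(nth_index e e'es) -[RHS](nth_index e ees); congr nth.
  apply/eqP; rewrite -(nth_uniq i _ _ uniq_es) ?size_map ?lt_index //.
  by rewrite !(nth_map e) ?lt_index // !nth_index // e'i ei.
exists (inord (index a cs), finfun g) => r t szr.
case/flattenP => _ /mapP[e ees ->] /mapP[t' t'e ->] agr /=.
rewrite inordK; last by rewrite (leq_trans _ cs_le) // index_mem.
have := agr _ (mem_head _ _); rewrite /cell /= => ->.
rewrite ffunE; apply: (gP e.1 e) => // p pt'.
by apply: agr; rewrite inE pt' orbT.
Qed.

End FullTrees.

(* Counting: all 2^#|R| functions on R would be given by full trees. *)
Lemma realizable_rows_bounded k h :
  exists B, forall (R : {fset seq 'I_k}) (c : nat),
    c <= #|` R| ->
    (forall nu : seq 'I_k -> bool, exists p : full_tree k c h,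
      {in R, full_tree_eval p =1 nu}) ->
  #|` R| <= B.
Proof.
have [B BP] := exp2_le_poly_bounded (k.+1 ^ h); exists B => R c cR nuP.
have {}nuP (f : {ffun R -> bool}) : exists p : full_tree k c h,
    forall r : R, full_tree_eval p (val r) = f r.
  (* The value outside [R] is immaterial. *)
  have [p pP] := nuP (fun r => if insub r is Some x then f x else false).
  by exists p => r; rewrite pP ?fsvalP // valK.
have [code codeP] := fin_all_exists nuP.
apply: BP; rewrite {1}cardfE -[X in X ^ _ <= _]card_bool -card_ffun.
have code_inj : injective code.
  by move=> f g fg; apply/ffunP => r; rewrite -!codeP fg.
apply: (leq_trans (leq_card code code_inj)).
apply: (leq_trans (card_full_tree k c h)).
by rewrite leq_exp2r ?expn_gt0 // leq_mul2l.
Qed.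

(** * From bounded row counts to bounded deterministic complexity *)

Section Measure.
Variables (k : nat) (psi : seq nat -> nat).
Hypotheses (hk : 0 < k) (hpsi : complexity_measure psi).
Implicit Types (T : table k) (A : set (table k)).

Lemma measure_nil : psi [::] = 0.
Proof. by have [psi0 _ _] := hpsi; apply/psi0. Qed.

Lemma measure_mem a w : a \in w -> psi [:: a] <= psi w.
Proof.
have [_ psi_perm psi_cat] := hpsi; move=> /perm_to_rem/psi_perm ->.
by have /andP[] := psi_cat [:: a] (rem a w).
Qed.

Lemma measure_le n w : (forall a, a \in w -> psi [:: a] <= n) ->
  psi w <= n * size w.
Proof.
elim: w => [|a w IH] wn; first by rewrite measure_nil.
have [_ _ psi_cat] := hpsi; have /andP[_] := psi_cat [:: a] w.
move/leq_trans; apply; rewrite mulnS leq_add ?wn ?mem_head // IH // => b bw.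
by rewrite wn // inE bw orbT.
Qed.

Lemma V_psi_leP T n :
  reflect (forall a, a \in cols T -> psi [:: a] <= n) (V_psi psi T <= n).
Proof.
apply: (iffP (bigmax_leqP_seq _ _ _ _)) => H a aT; first exact: H.
by move=> _; apply: H.
Qed.

Lemma F_definedP A : defined_everywhere (F_fun psi A) <->
  forall n, exists b, forall T, A T -> psi_s psi T <= n -> psi_d psi T <= b.
Proof.
split=> H n; have := H n.
  case/finite_maxP => b bP; exists b => T AT Tn; apply: bP; exists T => //.
case=> b bP; apply/finite_maxP; exists b => _ [T [AT Tn] <-]; exact: bP.
Qed.

Lemma N_definedP A : defined_everywhere (N_fun psi A) <->
  forall n, exists b, forall T, A T -> V_psi psi T <= n -> nrows T <= b.
Proof.
split=> H n; have := H n.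
  case/finite_maxP => b bP; exists b => T AT Tn; apply: bP; exists T => //.
case=> b bP; apply/finite_maxP; exists b => _ [T [AT Tn] <-]; exact: bP.
Qed.

(** E collects the attributes on all paths of an optimal tree. A path that accepts r also accepts
    any row agreeing with r on E, and a letter costs no more than the word containing it. *)
Lemma certificate_columns T : ~~ constant_table T ->
  exists E : seq nat, (forall a, a \in E -> psi [:: a] <= psi_s psi T) /\
    {in domf (rows T) &, forall r r',
      {in [seq a <- cols T | a \in E], cell (cols T) r =1 cell (cols T) r'} ->
      (rows T).[? r] = (rows T).[? r']}.
Proof.
move=> ncT; have [G /strongly_nondeterministic_treeP[_ _ _ covG constG] <-] :=
  psi_s_tree psi ncT.
exists (flatten [seq path_word t | t <- paths G]); split=> [a|].
  case/flattenP => _ /mapP[t tG ->] /measure_mem/leq_trans; apply.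
  exact: tree_complexity_ge.
set E := flatten _.
suff one r r' : r \in domf (rows T) -> r' \in domf (rows T) ->
    {in [seq a <- cols T | a \in E], cell (cols T) r =1 cell (cols T) r'} ->
    (rows T).[? r] = Some true -> (rows T).[? r'] = Some true.
  move=> r r' rT r'T eq_rr'.
  have := one r r' rT r'T eq_rr'.
  have := one r' r r'T rT (fun a aE => esym (eq_rr' a aE)).
  by rewrite !in_fnd; case: (rows T _) (rows T _) => [] [] // H1 H2;
    [rewrite H2 | rewrite H1].
move=> rT r'T eq_rr' /covG[t tG tr]; apply: (constG t tG r' r'T).
apply/(satisfiesP _ r'T) => c ct; move/(satisfiesP _ rT): tr => /(_ c ct) rc.
rewrite -eq_rr' // mem_filter (cell_mem rT rc) andbT.
apply/flattenP; exists (path_word t); apply: map_f => //.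
Qed.

Lemma psi_d_bound A n b : closed_class A ->
  (forall T, A T -> V_psi psi T <= n -> nrows T <= b) ->
  forall T, A T -> psi_s psi T <= n -> psi_d psi T <= n * b.
Proof.
move=> hA Nb T AT Tn; have [->|/eqP TL] := eqVneq T (Lambda k).
  by rewrite /psi_d eqxx.
have [/constant_tableP[d cT]|ncT] := boolP (constant_table T).
  (* A constant table is decided without any query, at cost 0. *)
  rewrite (leq_trans (psi_d_le psi (S := [::]) hk TL _ _)) ?measure_nil //.
  by move=> r r' rT r'T _; rewrite !cT.
have [E [En decE]] := certificate_columns ncT.
pose cs := [seq a <- cols T | a \in E].
have cs_n a : a \in cs -> psi [:: a] <= n.
  by rewrite mem_filter => /andP[/En/leq_trans-> //].
suff [S [Scs szS sepS]] : exists S, [/\ {subset S <= cs}, size S <= b &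
    {in domf (rows T) &, forall r r',
      {in S, cell (cols T) r =1 cell (cols T) r'} ->
      {in cs, cell (cols T) r =1 cell (cols T) r'}}].
  apply: (@leq_trans (psi S)).
    apply: psi_d_le => // [a /Scs|r r' rT r'T eqS].
      by rewrite mem_filter => /andP[].
    exact/decE/sepS.
  apply: (@leq_trans (n * size S)); last by rewrite leq_mul2l szS orbT.
  by apply: measure_le => a /Scs/cs_n.
(* Projection requires a remaining column; if there is none, the empty set separates vacuously. *)
have [cs0|cs0] := eqVneq cs [::].
  by exists [::]; split=> // r r' _ _ _ a; rewrite cs0.
have [T' [AT' colsT' rowsT' _]] :=
  closed_class_project (fun=> true) hA AT TL cs0.
(* Separating the rows of the projection [T'], not those of [T], is what bounds the size of S by
   b. *)
have [S [Scs szS sepS]] :=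
  separating_seq (cell cs) (enum_fset (domf (rows T'))) cs.
exists S; split=> // [|r r' rT r'T eqS a acs].
  by apply: (leq_trans szS); apply: Nb => //; apply/V_psi_leP; rewrite colsT'.
have proj r0 : r0 \in domf (rows T) ->
    delete_entries (outside E T) (cols T) r0 \in domf (rows T').
  by move=> r0T; rewrite rowsT'; apply: in_imfset.
have projE r0 c : r0 \in domf (rows T) -> c \in cs ->
    cell cs (delete_entries (outside E T) (cols T) r0) c = cell (cols T) r0 c.
  by rewrite mem_filter => r0T /andP[cE cT]; apply: cell_project.
rewrite -!projE //; apply: sepS => //; try exact: proj.
by move=> c /[dup] cS /Scs ccs; rewrite !projE //; apply: eqS.
Qed.

End Measure.

(** * From bounded deterministic complexity to bounded row counts *)

Section RowBound.
Variables (k : nat) (psi : seq nat -> nat) (A : set (table k)).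
Hypotheses (hk : 0 < k) (hpsi : complexity_measure psi).

(* R is the common row set and cs the list of columns of the tables obtained
   from a single table of A by varying the decisions of the rows. *)
Variables (R : {fset seq 'I_k}) (cs : seq nat) (n h : nat).
Hypothesis R_neq0 : R != fset0.
Hypothesis realize : forall nu : seq 'I_k -> bool, exists T,
  [/\ A T, cols T = cs, domf (rows T) = R
    & forall r, r \in domf (rows T) -> (rows T).[? r] = Some (nu r)].
Hypothesis cs_n : forall a, a \in cs -> psi [:: a] <= n.
Hypothesis F_n : forall T, A T -> psi_s psi T <= n -> psi_d psi T <= h.

Lemma realize_neq_Lambda T : domf (rows T) = R -> T <> Lambda k.
Proof. by move=> TR /LambdaP; rewrite TR (negPf R_neq0). Qed.

(* Give r the decision 0 and all other rows the decision 1: each of those has a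
   certificate of length 1, and the path of r in a deterministic tree separates
   r from all of them. *)
Lemma isolating_word r : r \in R -> exists w, psi (unzip1 w) <= h /\
  forall T, cols T = cs -> domf (rows T) = R ->
    forall r', r' \in R -> satisfies T w r' = (r' == r).
Proof.
move=> rR; have [T [AT Tcs TR Tnu]] := realize (fun x => x != r).
have rT : r \in domf (rows T) by rewrite TR.
have : psi_d psi T <= h.
  apply: F_n => //; apply: psi_s_le => r' r'1.
  have r'T : r' \in domf (rows T) by rewrite -fndSome r'1.
  have r'r : r' != r by move: r'1; rewrite Tnu // => -[].
  have [a aT neq] : exists2 a, a \in cols T &
      cell (cols T) r' a <> cell (cols T) r a.
    apply: contrapT => no; case/eqP: r'r.
    apply: (row_ext r'T rT) => a aT.
    by apply: contrapT => neq; apply: no; exists a.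
  have [i ci] := cell_some (size_row r'T) aT.
  exists [:: (a, i)]; split; first by rewrite cs_n // -Tcs.
    by apply/(satisfiesP _ r'T) => c; rewrite inE => /eqP->.
  move=> x xT /(satisfiesP _ xT)/(_ _ (mem_head _ _)) /= cx.
  rewrite Tnu //; congr Some; apply/eqP => xr; apply: neq.
  by rewrite ci -xr cx.
have [G /deterministic_treeP[_ _ _ covG constG] <-] :=
  psi_d_tree psi hk (realize_neq_Lambda TR).
move=> Gh; have [t tG tr] := covG r rT; exists t.1; split.
  exact: leq_trans (tree_complexity_ge psi tG) Gh.
move=> T' T'cs T'R r' r'R.
have -> : satisfies T' t.1 r' = satisfies T t.1 r'.
  by rewrite /satisfies T'cs Tcs.
(* The path of r ends with decision 0, which no other row has. *)
apply/idP/eqP => [tr'|->] //; have := constG _ tG r rT tr.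
have r'T : r' \in domf (rows T) by rewrite TR.
rewrite Tnu // eqxx => -[t2]; have := constG _ tG r' r'T tr'.
by rewrite Tnu // -t2 => -[/negbFE/eqP].
Qed.

(** Isolating words are certificates whatever the decisions, so each choice of decisions has a
    deterministic tree of cost at most m; boundedness of the measure turns this cost into depth. *)
Lemma realize_full_tree m c : bounded_measure psi -> 0 < size cs <= c.+1 ->
    (forall T, A T -> psi_s psi T <= h -> psi_d psi T <= m) ->
  forall nu : seq 'I_k -> bool, exists p : full_tree k c m,
    {in R, full_tree_eval p =1 nu}.
Proof.
move=> psi_size /andP[cs_gt0 cs_c] F_h nu.
have [T [AT Tcs TR Tnu]] := realize nu.
have : psi_d psi T <= m.
  apply: F_h => //; apply: psi_s_le => r r1.
  have rR : r \in R by rewrite -TR -fndSome r1.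
  have [w [wh wr]] := isolating_word rR; exists w; split=> //.
    by rewrite wr.
  by move=> r' r'T; rewrite wr -?TR // => /eqP->.
have [G /deterministic_treeP[_ [szG detG] attrG covG constG] <-] :=
  psi_d_tree psi hk (realize_neq_Lambda TR).
case: G szG detG attrG covG constG => [|v []] // _.
rewrite /attrs /paths /= !cats0 andbT => detv attrv covv constv vm.
have [||p pP] := full_tree_of_node cs_c (h := m) cs_gt0 detv.
- by rewrite -Tcs.
- move=> t tv; rewrite -(size_map fst) -/(unzip1 _).
  apply: leq_trans (psi_size _) _; apply: leq_trans vm.
  by apply: tree_complexity_ge; rewrite /paths /= cats0.
exists p => r rR; have rT : r \in domf (rows T) by rewrite TR.
have [t tv tr] := covv r rT.
have := constv t tv r rT tr; rewrite Tnu // => -[->].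
apply: pP => //; first by rewrite -Tcs (size_row rT).
by move=> c' c't; rewrite -Tcs; move/(satisfiesP _ rT): tr; apply.
Qed.

End RowBound.

Lemma nrows_bound k psi (A : set (table k)) : 0 < k ->
    complexity_measure psi -> bounded_measure psi -> closed_class A ->
    (forall n, exists b, forall T,
      A T -> psi_s psi T <= n -> psi_d psi T <= b) ->
  forall n, exists b, forall T, A T -> V_psi psi T <= n -> nrows T <= b.
Proof.
move=> hk hpsi psi_size hA F_def n.
have [h F_n] := F_def n; have [m F_h] := F_def h.
have [B BP] := realizable_rows_bounded k m.
(* The 1 serves tables whose separating set is empty, which have at most one row. *)
exists (maxn B 1) => T AT /V_psi_leP Tn; rewrite leq_max.
have [TL|TL] := pselect (T = Lambda k).
  by rewrite /nrows; move/LambdaP/eqP: TL => ->.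
have [S [ST szS sepS]] :=
  separating_seq (cell (cols T)) (enum_fset (domf (rows T))) (cols T).
pose cs := [seq a <- cols T | a \in S].
pose R := [fset delete_entries (outside S T) (cols T) r | r in domf (rows T)].
have R_nrows : #|` R| = nrows T.
  (* Since S separates the rows of [T], projecting on it merges none of them. *)
  rewrite /R /nrows card_in_imfset //= => r r' rT r'T eq_rr'.
  apply: (row_ext rT r'T); apply: sepS => // a aS; have aT := ST a aS.
  by rewrite -(cell_project rT aS aT) eq_rr' cell_project.
have [cs0|cs0] := eqVneq cs [::].
  apply/orP; right; rewrite -R_nrows -(cardfs1 ([::] : seq 'I_k)).
  apply/fsubset_leq_card/fsubsetP => _ /imfsetP[r /= rT ->].
  rewrite inE -size_eq0 size_delete_entries ?(size_row rT) //.
  by rewrite filter_outside -/cs cs0.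
(* Positions run from 0 to c inclusive, so c is one less than the number of columns kept. *)
apply/orP; left; rewrite -R_nrows; apply: (BP R (size cs).-1).
  rewrite R_nrows (leq_trans (leq_pred _)) // (leq_trans _ szS) //.
  apply: uniq_leq_size; first by rewrite filter_uniq // uniq_cols.
  by move=> a; rewrite mem_filter => /andP[].
have cs_gt0 : 0 < size cs by rewrite lt0n size_eq0.
apply: (@realize_full_tree k psi A hk R cs n h) => //.
- by rewrite -cardfs_eq0 R_nrows cardfs_eq0; apply/LambdaP.
- move=> nu.
  have [T' [AT' T'cs T'R T'nu]] := closed_class_project nu hA AT TL cs0.
  by exists T'.
- by move=> a; rewrite mem_filter => /andP[_ /Tn].
- by rewrite prednK // cs_gt0 leqnn.
Qed.

Theorem theorem4 (k : nat) (hk : 2 <= k) (psi : seq nat -> nat)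
    (hpsi : complexity_measure psi) (hbounded : bounded_measure psi)
    (A : set (table k)) (hA : closed_class A) :
  defined_everywhere (F_fun psi A) <-> defined_everywhere (N_fun psi A).
Proof.
have k_gt0 : 0 < k by apply: leq_trans hk.
split=> [/F_definedP F_def|/N_definedP N_def].
  exact/N_definedP/nrows_bound.
apply/F_definedP => n; have [b Nb] := N_def n; exists (n * b) => T AT Tn.
exact: (psi_d_bound k_gt0 hpsi hA Nb).
Qed.
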